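(* Let $(T_n)_{n\ge 1}$ be a uniform random recursive tree and let $R_n$ be the Jordan rank of the root (vertex $1$) in $T_n$. Then there exists an integer-valued random variable $R$ such that, with probability one, $\lim_{n\to\infty}R_n=R$.
   Context: A uniform random recursive tree (URRT) is a random sequence of trees $(T_n)_{n\ge 1}$ with $V(T_n)=[n]=\{1,\ldots,n\}$: $T_1$ is the single vertex $1$ (the root), and $T_{n+1}$ is obtained from $T_n$ by adding vertex $n+1$ and an edge $\{i,n+1\}$, where $i$ is chosen uniformly at random from $[n]$, independently of the past. For a tree $T$ and vertices $u,v$ of $T$, $(T,v)_{u\downarrow}$ denotes the subtree containing all vertices $w$ such that the path from $w$ to $v$ contains $u$ (rooted at $u$), and $|\cdot|$ denotes its number of vertices. The Jordan centrality of $v\in V(T_n)$ is $\psi_{T_n}(v)=\max_{u\in V(T_n)\setminus\{v\}}|(T_n,v)_{u\downarrow}|$; smaller values correspond to more central vertices. Ranking: vertices are ordered from most to least central; vertices with equal centrality value are ordered in reverse order of insertion time (if $u,v$ have equal centrality, $u$ is ranked before $v$ iff $u>v$). This gives a permutation $\gamma_n$ of $[n]$, where $\gamma_n(v)\in\{1,\ldots,n\}$ is the position of $v$ in this order (position $1$ being most central). The rank of the root is $R_n=\gamma_n(1)$. *)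

(* Defs.v *)
From HB Require Import structures.
From mathcomp Require Import all_boot all_order all_algebra.
From mathcomp Require Import all_classical all_reals all_analysis.
Import Order.TTheory GRing.Theory Num.Theory.
Import numFieldNormedType.Exports.

Set Implicit Arguments.
Unset Strict Implicit.
Unset Printing Implicit Defensive.

(** A graph on the vertex set [V] is given by its set of edges, an edge being
    an unordered pair [[set x; y]]. *)
Notation graph V := {set {set V}}.

Definition adj (V : finType) (E : graph V) : rel V :=
  fun x y => [set x; y]%SET \in E.

(** [w :: p] is a simple path of [E] from [w] to [v]; in a tree there is
    exactly one such [p]. *)
Definition simple_path (V : finType) (E : graph V) (w v : V) (p : seq V) :=
  [&& path (adj E) w p, last w p == v & uniq (w :: p)].

(** The vertex set of $(E,v)_{u\downarrow}$. *)
Definition subtree (V : finType) (E : graph V) (v u : V) : {set V} :=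
  [set w | `[< exists2 p, simple_path E w v p & u \in w :: p >]]%SET.

Definition jordan (V : finType) (E : graph V) (v : V) : nat :=
  \max_(u : V | u != v) #|subtree E v u|.

(** Vertices are compared by insertion time, which is their value in [nat];
    ties go to the later vertex.  This is a total order. *)
Definition ranked_before (n : nat) (E : graph 'I_n) : rel 'I_n :=
  fun u v => (jordan E u < jordan E v)%N
          || (jordan E u == jordan E v) && (v <= u)%N.

(** Positions start at 1. *)
Definition jordan_rank (n : nat) (E : graph 'I_n) (v : 'I_n) : nat :=
  (index v (sort (ranked_before E) (enum 'I_n))).+1.

Definition attach (n : nat) (E : graph 'I_n) (i : 'I_n) : graph 'I_n.+1 :=
  let old := widen_ord (leqnSn n) in
  ([set (old @: e)%SET | e : {set 'I_n} in E]
     :|: [set [set old i; ord_max]])%SET.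

Local Open Scope classical_set_scope.
Local Open Scope ring_scope.

(** [T] is a uniform random recursive tree.  Indices and labels are shifted
    down by one: [T n] is the tree $T_{n+1}$, and the ordinal [i : 'I_n.+1] is
    the vertex labelled $i+1$, so that [ord0] is the root.  [A n] is the vertex
    of $T_{n+1}$ to which the next vertex is attached.  The past
    $(T_1,\dots,T_{n+1})$ takes finitely many values, so independence from it is
    the product rule on its values [t]. *)
Definition is_URRT (R : realType) (d : measure_display)
    (Omega : measurableType d) (P : probability Omega R)
    (T : forall n : nat, Omega -> graph 'I_n.+1) : Prop :=
  exists A : forall n : nat, Omega -> 'I_n.+1,
  [/\ forall n (i : 'I_n.+1), measurable [set w | A n w = i],
      forall w, T 0%N w = finset.set0,
      forall n w, T n.+1 w = attach (T n w) (A n w),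
      forall n (i : 'I_n.+1), P [set w | A n w = i] = (n.+1%:R^-1)%:E
    & forall n (i : 'I_n.+1) (t : forall k : nat, graph 'I_k.+1),
        let past := [set w | forall k, (k <= n)%N -> T k w = t k] in
        P ([set w | A n w = i] `&` past)
        = (P [set w | A n w = i] * P past)%E].

(* Main.v *)
Require Import Defs.
From HB Require Import structures.
From mathcomp Require Import all_boot all_order all_algebra.
From mathcomp Require Import all_classical all_reals all_analysis.
From mathcomp Require Import zify ring lra.
Import Order.TTheory GRing.Theory Num.Theory.
Import numFieldNormedType.Exports.

Set Implicit Arguments.
Unset Strict Implicit.
Unset Printing Implicit Defensive.

Local Open Scope classical_set_scope.
Local Open Scope ring_scope.

(** Let [n] be the number of vertices and let [weight v] be the number of
    descendants of [v] when the tree is rooted at its first vertex.  A vertex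
    [v] other than the root is ranked before the root iff
    [weight v + weight c >= n] for some ancestor [c] of [v] other than the root
    ([c = v] allowed).  So it suffices that almost surely each such inequality
    is eventually always true or always false, and that only finitely many [v]
    ever satisfy one.  Both follow from the maximal inequality for nonnegative
    supermartingales.

    - For fixed [c] and [v], the numbers [x = weight v] and [y = n - weight c]
      evolve as a Polya urn with holding times, so [x - y] moves by at most one
      and it suffices to exclude infinitely many ties [x = y].  The function
      [(x + y) / ((x - y)^2 + 3 (x + y))] equals [1/3] at a tie, and its
      expectation is multiplied by at most [1 - 1/(8 n)] at each step, hence it
      tends to [0].
    - If [y = n - weight c], then [1/y + ... + 1/(n - 1)] is a martingale, so
      almost surely [n / y] is bounded for each [c].
    - [weight v (weight v + 1) / (n (n + 1))] is a martingale that starts from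
      [2 / (v (v + 1))] for the vertex with label [v].  The sum over [v] is
      finite, so for each [eps] only finitely many vertices ever satisfy
      [weight v >= eps n]. *)

(** * Recursive trees as lists *)

Section Histories.
Local Open Scope nat_scope.
Implicit Types (s : seq nat) (u v w c i : nat).

(** A tree is encoded by the list of the parents of its vertices, most recent
    vertex first: in [i :: s], the vertex [size s + 1] is attached to [i].  The
    root [0] has no entry, so [s] describes a tree with [size s + 1] vertices. *)
Fixpoint valid s : bool := if s is i :: s' then (i <= size s') && valid s' else true.

(** The recursion removes the newest vertex, a leaf; a label not in the tree is its own only
    ancestor. *)
Fixpoint anc s u v : bool :=
  if s is i :: s' then
    if v == size s then (u == v) || anc s' u i else anc s' u v
  else u == v.

Definition weight s u : nat := \sum_(w < (size s).+1) anc s u w.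

(** [u] lies on the path from [w] to [v]. *)
Fixpoint btw s w u v : bool :=
  if s is i :: s' then
    if w == size s then (u == w) || (v != size s) && btw s' i u v
    else if v == size s then (u == v) || btw s' w u i
    else btw s' w u v
  else (u == w) && (u == v).

Lemma anc_refl s v : anc s v v.
Proof. by elim: s => [|i s IH] //=; rewrite eqxx /=; case: ifP. Qed.

Lemma anc_leq s u v : valid s -> anc s u v -> u <= v.
Proof.
elim: s u v => [|i s IH] u v /=; first by move=> _ /eqP->.
move=> /andP[lei vs]; case: eqP => [->|_]; last exact: IH.
by case/orP => [/eqP-> //|/(IH _ _ vs)]; lia.
Qed.

Lemma anc_cons s i u v : v <= size s -> anc (i :: s) u v = anc s u v.
Proof. by move=> le_v /=; rewrite ltn_eqF. Qed.

Lemma anc_trans s u v w : valid s -> w <= size s ->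
  anc s u v -> anc s v w -> anc s u w.
Proof.
elim: s u v w => [|i s IH] u v w /=; first by move=> _ _ /eqP-> /eqP->.
move=> /andP[lei vs] lew.
have [->|nw] := eqVneq w (size s).+1.
  have [->|nv] := eqVneq v (size s).+1; first by case/orP => [->|->] //; rewrite orbT.
  by move=> uv vi; apply/orP; right; apply: IH uv vi.
have lews : w <= size s by lia.
move=> + vw; have := anc_leq vs vw => levw.
by rewrite ltn_eqF; [move=> uv; apply: IH uv vw|lia].
Qed.

Lemma anc_chain s u v w : valid s -> w <= size s ->
  anc s u w -> anc s v w -> anc s u v || anc s v u.
Proof.
elim: s u v w => [|i s IH] u v w /=.
  by move=> _ _ /eqP-> /eqP->; rewrite eqxx.
move=> /andP[lei vs] lew.
have [->|nw] := eqVneq w (size s).+1.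
  case/orP => [/eqP->|ui] /orP[/eqP->|vi]; rewrite ?eqxx /= ?vi ?ui ?orbT //.
  have /= := anc_leq vs ui; have /= := anc_leq vs vi => lv lu.
  rewrite !ltn_eqF; [|lia..]; exact: IH ui vi.
move=> uw vw.
have /= := anc_leq vs uw; have /= := anc_leq vs vw => lv lu.
rewrite !ltn_eqF; [|lia..]; apply: IH uw vw => //; lia.
Qed.

Lemma anc0 s v : valid s -> v <= size s -> anc s 0 v.
Proof.
elim: s v => [|i s IH] v /=; first by rewrite leqn0 => _ /eqP->.
move=> /andP[lei vs] lev; case: eqP => [_|nv]; last by apply: IH => //; lia.
by rewrite IH ?orbT.
Qed.

Lemma btw_root s u w : valid s -> w <= size s -> btw s w u 0 = anc s u w.
Proof.
elim: s w => [|i s IH] w /=.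
  by rewrite leqn0 => _ /eqP->; rewrite andbb.
move=> /andP[lei vs] lew.
by have [->|nw] := eqVneq w (size s).+1; rewrite /= IH //; lia.
Qed.

Lemma btw_end s w v : valid s -> w <= size s -> v <= size s -> btw s w v v.
Proof.
elim: s w v => [|i s IH] w v /=.
  by rewrite !leqn0 => _ /eqP-> /eqP->.
move=> /andP[lei vs] lew lev.
have [->|nw] := eqVneq w (size s).+1; have [->|nv] := eqVneq v (size s).+1 => //=; rewrite ?eqxx //.
  by apply: IH; lia.
by apply: IH; lia.
Qed.

(** When [u] is not on the path from the root to [v], whatever [u] separates from [v] it also
    separates from the root. *)
Lemma btw_anc s w u v : valid s -> w <= size s ->
  ~~ anc s u v -> btw s w u v -> anc s u w.
Proof.
elim: s w v => [|i s IH] w v /=; first by move=> _ _ _ /andP[].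
move=> /andP[lei vs] lew.
have [->|nw] := eqVneq w (size s).+1; have [->|nv] := eqVneq v (size s).+1 => //=.
- by move=> /norP[/negPf->].
- by move=> nuv /orP[->//|/IH->//]; rewrite orbT.
- move=> /norP[/negPf-> nui] /= h; apply: IH nui h => //; lia.
- move=> nuv h; apply: IH nuv h => //; lia.
Qed.

(** A path from a descendant of [v] up to [v] stays below [v], so it misses the proper ancestors of
    [v]. *)
Lemma btwN s w u v : valid s -> w <= size s -> v <= size s ->
  anc s u v -> u != v -> anc s v w -> ~~ btw s w u v.
Proof.
elim: s w v => [|i s IH] w v /=; first by move=> _ _ _ /eqP->; rewrite eqxx.
move=> /andP[lei vs] lew lev.
have [->|nw] := eqVneq w (size s).+1; have [->|nv] := eqVneq v (size s).+1 => //=.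
- by move=> _ /negPf->.
- move=> uv nuv vi; rewrite negb_or IH ?andbT //; last lia.
  by have := anc_leq vs uv; lia.
- by move=> _ _ /(anc_leq vs); lia.
- by move=> *; apply: IH => //; lia.
Qed.

Lemma btw_big s w u v : valid s -> w <= size s -> v <= size s -> size s < u ->
  btw s w u v = false.
Proof.
elim: s w v => [|i s IH] w v /=; first by rewrite !leqn0 => _ /eqP-> _; case: u.
move=> /andP[lei vs] lew lev ltu.
have [->|nw] := eqVneq w (size s).+1; have [->|nv] := eqVneq v (size s).+1 => //=.
- by rewrite gtn_eqF.
- by rewrite gtn_eqF ?IH //; lia.
- by rewrite gtn_eqF ?IH //; lia.
- by rewrite IH //; lia.
Qed.

(** The witness is the parent of [v], through which every path from outside the descendants of [v]
    arrives. *)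
Lemma btw_parent s v : valid s -> 0 < v <= size s ->
  exists2 u, u < v & forall w, w <= size s -> ~~ anc s v w -> btw s w u v.
Proof.
elim: s v => [|i s IH] v /=; first by lia.
move=> /andP[lei vs] lev.
have [->|nv] := eqVneq v (size s).+1.
  exists i; first by lia.
  move=> w lew; have [->|nw] := eqVneq w (size s).+1 => //.
  by move=> _; rewrite btw_end ?orbT //; lia.
have [|u ltu Hu] := IH v vs; first lia.
exists u => // w lew; have [->|nw] := eqVneq w (size s).+1.
  by move=> /norP[_ /(Hu _ lei)->]; rewrite orbT.
by apply: Hu; lia.
Qed.

Lemma weight_cons s i u : valid (i :: s) -> u <= size s ->
  weight (i :: s) u = weight s u + anc s u i.
Proof.
move=> /= /andP[lei vs] leu; rewrite /weight big_ord_recr /= eqxx (ltn_eqF (m := u)) //=.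
by congr (_ + _); apply: eq_bigr => w _; rewrite ltn_eqF.
Qed.

Lemma weight_new s i : valid (i :: s) -> weight (i :: s) (size s).+1 = 1.
Proof.
move=> vs; rewrite /weight big_ord_recr /= eqxx /= big1 ?addn1 // => w _.
rewrite ltn_eqF //; case: (boolP (anc _ _ _)) => // h.
by by case/andP: vs => _ vs; have := anc_leq vs h; have := ltn_ord w; rewrite ltnNge => /[swap] ->.
Qed.

Lemma weight_gt0 s u : u <= size s -> 0 < weight s u.
Proof.
move=> leu; rewrite /weight (bigD1 (Ordinal (leu : u < (size s).+1))) //= anc_refl; lia.
Qed.

Lemma weight_anc s u v : valid s -> anc s u v -> weight s v <= weight s u.
Proof.
move=> vs uv; apply: leq_sum => w _; case: (boolP (anc s v w)) => // vw.
by rewrite (anc_trans vs (ltn_ord w) uv vw).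
Qed.

Lemma weight_leq s c : valid s -> 0 < c -> weight s c <= size s.
Proof.
move=> vs c0; rewrite /weight big_ord_recl.
case: (boolP (anc s c _)) => [/anc_leq|_]; first by move=> /(_ vs) /=; lia.
rewrite add0n -[leqRHS]card_ord -sum1_card; apply: leq_sum => w _; exact: leq_b1.
Qed.

(** By [anc_chain] no vertex descends from both, and the root descends from neither. *)
Lemma weight_disjoint s u v : valid s -> 0 < u -> 0 < v ->
  ~~ anc s u v -> ~~ anc s v u -> weight s u + weight s v <= size s.
Proof.
move=> vs u0 v0 uv vu; rewrite /weight -big_split big_ord_recl /=.
have -> : anc s u 0 = false by apply/negP => /(anc_leq vs); lia.
have -> : anc s v 0 = false by apply/negP => /(anc_leq vs); lia.
rewrite /= -[leqRHS]card_ord -sum1_card; apply: leq_sum => w _.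
case: (boolP (anc s u _)) => [uw|_]; last exact: leq_b1.
case: (boolP (anc s v _)) => // vw.
have lew : lift ord0 w <= size s by rewrite lift0.
by have := anc_chain vs lew uw vw; rewrite (negPf uv) (negPf vu).
Qed.

(** The tree has [size s + 1] vertices, hence the strict inequality. The range leaves out the root;
    by [anc_leq] it contains every other ancestor of [v]. *)
Definition beats_root s v : bool :=
  has (fun c => anc s c v && (size s < weight s v + weight s c)) (iota 1 v).

Lemma beats_rootP s v :
  reflect (exists c, [/\ 0 < c, c <= v, anc s c v & size s < weight s v + weight s c])
    (beats_root s v).
Proof.
apply: (iffP hasP) => [[c]|[c [c0 cv h1 h2]]].
  by rewrite mem_iota => /andP[? ?] /andP[? ?]; exists c; split=> //; lia.
by exists c; rewrite ?mem_iota ?h1 //; lia.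
Qed.

End Histories.

(** * Paths in a tree with a new leaf *)

Section AttachedTree.
Local Open Scope nat_scope.

Definition between (V : finType) (E : graph V) (w u v : V) : Prop :=
  exists2 p, simple_path E w v p & u \in w :: p.

Lemma adj_sym (V : finType) (E : graph V) (x y : V) : adj E x y = adj E y x.
Proof. by rewrite /adj finset.setUC. Qed.

Lemma between_sym (V : finType) (E : graph V) (w u v : V) :
  between E w u v -> between E v u w.
Proof.
move=> [p /and3P[pp /eqP pl pu] up]; 
have e : v :: rev (belast w p) = rev (w :: p) by rewrite (lastI w p) rev_rcons pl.
exists (rev (belast w p)); last by rewrite e mem_rev.
rewrite /simple_path e rev_uniq pu andbT -pl rev_path; apply/andP; split.
  by rewrite (eq_path (e' := adj E)) // => x y; rewrite adj_sym.
by case: p {pp pl pu up e} => [|x p] //=; rewrite rev_cons last_rcons.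
Qed.

Lemma between_start (V : finType) (E : graph V) (w u v : V) :
  between E w u v -> between E w w v.
Proof. by move=> [p sp _]; exists p; rewrite ?mem_head. Qed.

Variables (n : nat) (E : graph 'I_n) (i : 'I_n).
Let old : 'I_n -> 'I_n.+1 := widen_ord (leqnSn n).
Let new : 'I_n.+1 := ord_max.
Let E' := attach E i.

Let old_inj : injective old.
Proof. by move=> x y /(congr1 val) /= /val_inj. Qed.

Let old_new x : (old x == new) = false.
Proof. by apply/negbTE; rewrite -val_eqE /= ltn_eqF. Qed.

Let oldP (x : 'I_n.+1) : x = new \/ exists y, x = old y.
Proof.
have [->|nx] := eqVneq x new; [by left|right].
have ltx : x < n by have := ltn_ord x; rewrite -val_eqE /= in nx; lia.
by exists (Ordinal ltx); apply: val_inj.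
Qed.


Let old_pair x y : [set old x; old y]%SET = (old @: [set x; y])%SET.
Proof. by rewrite imsetU1 imset_set1. Qed.

Let new_notin (e : {set 'I_n}) : new \notin (old @: e)%SET.
Proof. by apply/imsetP => -[x _] /eqP; rewrite eq_sym old_new. Qed.

Lemma adj_attach_old x y : adj E' (old x) (old y) = adj E x y.
Proof.
rewrite /adj /E' /attach !inE old_pair; apply/orP/idP => [[]|xy].
- by move=> /imsetP[e eE] /(imset_inj old_inj) ->.
- move=> /eqP h; have := new_notin [set x; y]%SET.
  by rewrite h !inE eqxx orbT.
- by left; apply: imset_f.
Qed.

Lemma adj_attach_new x : adj E' (old x) new = (x == i).
Proof.
rewrite /adj /E' /attach !inE; apply/orP/eqP => [[]|->]; last by right.
- move=> /imsetP[e eE] h; have := new_notin e.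
  by rewrite -h !inE eqxx orbT.
- move=> /eqP h; have : old x \in [set old i; new]%SET by rewrite -h !inE eqxx.
  by rewrite !inE old_new orbF => /eqP /old_inj.
Qed.

Lemma simple_path_old w v p :
  simple_path E' (old w) (old v) (map old p) = simple_path E w v p.
Proof.
rewrite /simple_path -map_cons (map_inj_uniq old_inj) last_map (inj_eq old_inj).
by rewrite path_map (eq_path (e' := adj E)) // => x y; exact: adj_attach_old.
Qed.

Let map_oldP (p : seq 'I_n.+1) : new \notin p -> exists q, p = map old q.
Proof.
elim: p => [|x p IH]; first by exists [::].
rewrite inE => /norP[nx /IH[q ->]].
have [e|[y ->]] := oldP x; first by rewrite e eqxx in nx.
by exists (y :: q).
Qed.

(* The new vertex is a leaf, so a simple path cannot pass through it. *)
Lemma new_notin_path w v p : simple_path E' (old w) (old v) p -> new \notin p.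
Proof.
move=> /and3P[pp lp up]; apply/negP => np.
case/splitPr: np pp lp up => p1 p2; rewrite cat_path last_cat => /and3P[_ h1 h2].
case: p2 h2 => [|y p2]; first by rewrite /= eq_sym old_new.
move=> /andP[h2 _] _; rewrite -cat_cons cat_uniq => /and3P[_ /hasPn h3 /andP[h4 _]].
have {h4} ny : new != y by move: h4; rewrite inE; case: eqP.
have [e|[z ez]] := oldP y; first by rewrite e eqxx in ny.
move: h2; rewrite ez adj_sym adj_attach_new => /eqP ezi.
have [e|[z' ez']] := oldP (last (old w) p1).
  have := h3 new; rewrite mem_head => /(_ isT).
  by move=> /negP; apply; rewrite -[X in X \in _]e; exact: mem_last.
move: h1; rewrite ez' adj_attach_new => /eqP ezi'.
have := h3 y; rewrite !inE eqxx orbT => /(_ isT) /negP; apply.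
by rewrite ez ezi -ezi' -ez'; exact: mem_last.
Qed.

Lemma between_old w u v : between E' (old w) (old u) (old v) <-> between E w u v.
Proof.
split=> [[p sp up]|[p sp up]].
  have [q e] := map_oldP (new_notin_path sp); exists q.
    by rewrite -simple_path_old -e.
  by move: up; rewrite e -map_cons (mem_map old_inj).
exists (map old p); first by rewrite simple_path_old.
by rewrite -map_cons (mem_map old_inj).
Qed.

Lemma between_old_new w v : ~ between E' (old w) new (old v).
Proof.
move=> [p sp]; rewrite inE (eq_sym new) old_new /=.
exact/negP/(new_notin_path sp).
Qed.

Lemma between_new_old u v : between E' new (old u) (old v) <-> between E i u v.
Proof.
split=> [[p /and3P[pp lp up]]|[p /and3P[pp lp up] ip]].
  case: p pp lp up => [|x p]; first by rewrite /= (eq_sym new) old_new.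
  move=> /= /andP[h1 h2] lp /andP[nxp upx].
  have /norP[nx np] : ~~ ((new == x) || (new \in p)) by rewrite -in_cons.
  have [e|[y ey]] := oldP x; first by rewrite e eqxx in nx.
  move: h1; rewrite ey adj_sym adj_attach_new => /eqP ei; subst y x.
  rewrite inE old_new /= => ux; apply/between_old; exists p => //.
  by rewrite /simple_path h2 lp.
exists (old i :: map old p); last by rewrite inE -map_cons (mem_map old_inj) ip orbT.
have := simple_path_old i v p; rewrite {2}/simple_path pp lp up => /and3P[h1 h2 h3].
rewrite /simple_path cons_uniq h3 h2 andbT /= adj_sym adj_attach_new eqxx h1 /=.
by rewrite -map_cons; apply/mapP => -[x _] /eqP; rewrite eq_sym old_new.
Qed.


Lemma between_new_new u : between E' new u new <-> u = new.
Proof.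
split=> [[[|x p]]|->]; last by exists [::]; rewrite ?mem_head // /simple_path /= eqxx.
  by rewrite inE => _ /eqP.
case/and3P=> _ /eqP lp; rewrite cons_uniq -{1}lp => /andP[].
by rewrite /= mem_last.
Qed.

End AttachedTree.

(** * Agreement of graph paths with the list encoding *)

Section Encoding.
Local Open Scope nat_scope.

Definition encodes n (E : graph 'I_n.+1) (s : seq nat) : Prop :=
  [/\ size s = n, valid s
    & forall w u v : 'I_n.+1, between E w u v <-> btw s w u v].

Lemma encodes_set0 : @encodes 0 finset.set0 [::].
Proof.
split=> // w u v; rewrite !ord1 /=; split=> // _.
by exists [::]; rewrite ?mem_head // /simple_path /= eqxx.
Qed.

(** The cases of which vertices are new match the branches of [btw]; symmetry reduces a new [v] to a
    new [w]. *)
Lemma encodes_attach n (E : graph 'I_n.+1) s (i : 'I_n.+1) :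
  encodes E s -> encodes (attach E i) (val i :: s).
Proof.
move=> [sn vs b]; split; first by rewrite /= sn.
  by rewrite /= sn vs andbT -ltnS.
have casesP (x : 'I_n.+2) : x = ord_max \/ exists y : 'I_n.+1, x = widen_ord (leqnSn _) y.
  have [->|nx] := eqVneq x ord_max; [by left|right].
  have ltx : x < n.+1 by have := ltn_ord x; rewrite -val_eqE /= in nx; lia.
  by exists (Ordinal ltx); apply: val_inj.
move=> w u v /=; rewrite sn.
have [->|[{}w ->]] := casesP w.
  have [->|[{}v ->]] := casesP v; rewrite /= eqxx.
    rewrite orbF; apply: (iff_trans (between_new_new _ _ _)).
    by split=> [->//|/eqP h]; exact: val_inj.
  rewrite (ltn_eqF (ltn_ord v)) /=.
  have [->|[{}u ->]] := casesP u; rewrite /= ?eqxx ?(ltn_eqF (ltn_ord u)) /=.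
    split=> // _; apply: (@between_start _ _ _ (widen_ord _ v)).
    by apply/between_new_old/b/btw_end; rewrite ?sn // leq_ord.
  exact: (iff_trans (between_new_old _ _ _ _)).
rewrite (ltn_eqF (ltn_ord w)).
have [->|[{}v ->]] := casesP v; rewrite /= ?eqxx ?(ltn_eqF (ltn_ord v)) /=.
  have [->|[{}u ->]] := casesP u; rewrite /= ?eqxx ?(ltn_eqF (ltn_ord u)) /=.
    split=> // _; apply: between_sym; apply: (@between_start _ _ _ (widen_ord _ w)).
    by apply/between_new_old/b/btw_end; rewrite ?sn // leq_ord.
  split=> [/between_sym/between_new_old/between_sym/b//|/b/between_sym h].
  exact/between_sym/between_new_old.
have [->|[{}u ->]] := casesP u; last exact: (iff_trans (between_old _ _ _ _ _)).
split=> [/between_old_new//|/= h]; exfalso; move: h.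
by rewrite btw_big ?sn // leq_ord.
Qed.

End Encoding.

(** Split the list at [x]: every entry before it is related to [x], and by antisymmetry none after
    it is. This turns a rank into a count. *)
Lemma index_sorted (T : eqType) (r : rel T) (s : seq T) (x : T) :
  total r -> transitive r -> antisymmetric r -> uniq s -> x \in s -> sorted r s ->
  index x s = count (fun u => (u != x) && r u x) s.
Proof.
move=> rtot rtr ras us /splitPr sp; case: sp us => p1 p2.
rewrite cat_uniq /= => /and4P[_ /norP[xp1 _] xp2 _].
rewrite sorted_cat_cons // => /andP[s1 s2].
rewrite index_cat (negPf xp1) /= eqxx addn0 count_cat /= eqxx /=.
rewrite (_ : count _ p1 = size p1); last first.
  apply/eqP; rewrite -all_count; apply/allP => u up.
  have rux : r u x.
    move: s1; rewrite -cats1 sorted_pairwise // pairwise_cat => /andP[/allrelP + _].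
    by apply; rewrite ?inE.
  by rewrite rux andbT; apply: contraNneq xp1 => <-.
rewrite (_ : count _ p2 = 0%N) ?addn0 //.
apply/eqP; rewrite -leqn0 leqNgt -has_count; apply/hasPn => u up.
have rxu : r x u by move: s2; rewrite (path_sortedE rtr) => /andP[/allP h _]; exact: h.
rewrite negb_and negbK; case: eqP => //= nux; apply/negP => rux.
by apply: nux; apply: ras; rewrite rux.
Qed.

(** * The rank of the root *)

Section Rank.
Local Open Scope nat_scope.
Variables (n : nat) (E : graph 'I_n.+1) (s : seq nat).
Hypothesis enc : encodes E s.

Let sn : size s = n. Proof. by case: enc. Qed.
Let vs : valid s. Proof. by case: enc. Qed.

Lemma mem_subtree (v u w : 'I_n.+1) : (w \in subtree E v u) = btw s w u v.
Proof.
by case: enc => _ _ b; rewrite inE; apply/asboolP/idP => [/b|/b].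
Qed.

Lemma card_anc (u : 'I_n.+1) : #|[set w : 'I_n.+1 | anc s u w]%SET| = weight s u.
Proof. by rewrite -sum1dep_card big_mkcond /weight sn; apply: eq_bigr => w _; case: anc. Qed.

Lemma subtree_jordan (u v : 'I_n.+1) : u != v -> #|subtree E v u| <= jordan E v.
Proof. exact: (@leq_bigmax_cond _ (fun u => u != v) (fun u => #|subtree E v u|) u). Qed.

Lemma jordan_root (u : 'I_n.+1) : u != ord0 -> weight s u <= jordan E ord0.
Proof.
move=> u0; rewrite -card_anc; apply: leq_trans (subtree_jordan u0).
apply: subset_leq_card; apply/fintype.subsetP => w; rewrite mem_subtree inE.
by rewrite btw_root // sn -ltnS.
Qed.

(** The centrality of the root is the largest weight of another vertex, while from [v] the branch
    towards its parent has [n + 1 - weight s v] vertices. *)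
Lemma jordan_leP (v : 'I_n.+1) : v != ord0 ->
  (jordan E v <= jordan E ord0) = beats_root s v.
Proof.
move=> v0; have v_gt0 : 0 < v by rewrite lt0n -val_eqE in v0 *.
have le_s (w : 'I_n.+1) : w <= size s by rewrite sn -ltnS.
apply/idP/beats_rootP => [le|[c [c0 cv acv lt]]]; last first.
  have ltc : c < n.+1 by apply: leq_ltn_trans cv _.
  have cE : weight s c <= jordan E ord0.
    by apply: (jordan_root (u := Ordinal ltc)); rewrite -val_eqE /= -lt0n.
  (* Seen from [v], a branch through an ancestor [u] avoids all descendants of [v]; any other branch
     consists of descendants of [u]. *)
  apply/bigmax_leqP => u uv; have [auv|nauv] := boolP (anc s u v).
    apply: leq_trans cE; rewrite -(leq_add2l (weight s v)).
    apply: leq_trans lt; rewrite sn -[leqRHS]card_ord -(cardsC [set w : 'I_n.+1 | anc s v w]%SET).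
    rewrite card_anc leq_add2l; apply: subset_leq_card; apply/fintype.subsetP => w.
    rewrite mem_subtree !inE => bw; apply/negP => vw.
    by move: (btwN vs (le_s _) (le_s _) auv uv vw); rewrite bw.
  have u0 : u != ord0 by apply: contraNneq nauv => ->; exact: anc0.
  apply: leq_trans (jordan_root u0); rewrite -card_anc.
  apply: subset_leq_card; apply/fintype.subsetP => w; rewrite mem_subtree inE.
  exact: btw_anc.
have [|p ltp Hp] := @btw_parent s v vs; first by rewrite v_gt0 le_s.
have ltpn : p < n.+1 by apply: ltn_trans (ltn_ord v).
have le1 : n.+1 <= weight s v + jordan E v.
  rewrite -[leqLHS]card_ord -(cardsC [set w : 'I_n.+1 | anc s v w]%SET) card_anc leq_add2l.
  have pv : Ordinal ltpn != v by rewrite -val_eqE /= neq_ltn ltp.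
  apply: leq_trans (subtree_jordan pv).
  apply: subset_leq_card; apply/fintype.subsetP => w; rewrite mem_subtree !inE; exact: Hp.
(* [m] is a non-root vertex of largest weight. If it were incomparable with [v], the two weights
   would sum to at most [n]; so the upper one of the two serves as [c]. *)
have [m m0 jm] : exists2 m : 'I_n.+1, m != ord0 & jordan E ord0 <= weight s m.
  rewrite {1}/jordan (bigop.bigmax_eq_arg v) //; case: arg_maxnP => //= m m0 _.
  exists m => //; rewrite -card_anc; apply: subset_leq_card; apply/fintype.subsetP => w.
  by rewrite mem_subtree inE btw_root.
have m_gt0 : 0 < m by rewrite lt0n -val_eqE in m0 *.
have le2 : n < weight s v + weight s m by lia.
have [mv|nmv] := boolP (anc s m v).
  exists m; split; rewrite ?sn //; exact: anc_leq mv.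
have [vm|nvm] := boolP (anc s v m).
  exists v; split; rewrite ?sn ?anc_refl //.
  have := weight_anc vs vm; lia.
by have := weight_disjoint vs v_gt0 m_gt0 nvm nmv; rewrite sn; lia.
Qed.

Lemma rank_root : jordan_rank E ord0 = (count (beats_root s) (iota 1 n)).+1.
Proof.
have rtot : total (ranked_before E).
  move=> x y; rewrite /ranked_before; have := leq_total x y.
  by case: ltngtP => //= _ /orP[]->; rewrite ?orbT.
have rtr : transitive (ranked_before E).
  move=> y x z; rewrite /ranked_before => /orP h1 /orP h2; apply/orP.
  case: h1 h2 => [h1|/andP[/eqP -> h1]] [h2|/andP[/eqP <- h2]].
  - left; exact: ltn_trans h2.
  - by left.
  - by left.
  - by right; rewrite eqxx (leq_trans h2 h1).
have ras : antisymmetric (ranked_before E).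
  move=> x y; rewrite /ranked_before; case: ltngtP => //= _ /andP[h1 h2].
  by apply: val_inj; apply/eqP; rewrite eqn_leq h1 h2.
rewrite /jordan_rank; congr _.+1.
rewrite (index_sorted rtot) // ?sort_uniq ?enum_uniq ?mem_sort ?mem_enum ?sort_sorted //.
rewrite (permP (permEl (perm_sort _ _))).
transitivity (count (fun v => (v != 0) && beats_root s v) (map val (enum 'I_n.+1))).
  rewrite [RHS]count_map; apply: eq_count => u /=.
  rewrite -(inj_eq val_inj) /=; case: (eqVneq (val u) 0) => //= u0.
  (* The root has the smallest label and loses every tie, so a weak inequality of centralities
     decides. *)
  by rewrite -jordan_leP // /ranked_before leq0n andbT [RHS]leq_eqVlt orbC.
rewrite val_enum_ord /=; apply: eq_in_count => u; rewrite mem_iota; case: u => //.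
Qed.

End Rank.

(** * Maximal inequality *)

Section Probability.

(** The sum runs over the equally likely parents of the next vertex; divided by [(size s).+1], it is
    the conditional expectation given the history [s]. *)
Definition supermartingale (R : realType) (f : seq nat -> R) : Prop :=
  (forall s, valid s -> 0 <= f s) /\
  (forall s, valid s -> \sum_(i < (size s).+1) f (val i :: s) <= (size s).+1%:R * f s).

Fixpoint hist (Omega : Type) (A : forall n : nat, Omega -> 'I_n.+1) n (w : Omega) : seq nat :=
  if n is k.+1 then val (A k w) :: hist A k w else [::].

Section HistTheory.
Variables (Omega : Type) (A : forall n : nat, Omega -> 'I_n.+1).

Lemma size_hist n w : size (hist A n w) = n.
Proof. by elim: n => //= n ->. Qed.

Lemma valid_hist n w : valid (hist A n w).
Proof. by elim: n => //= n ->; rewrite size_hist andbT -ltnS. Qed.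

Lemma encodes_hist (T : forall n : nat, Omega -> graph 'I_n.+1) :
  (forall w, T 0%N w = finset.set0) ->
  (forall n w, T n.+1 w = attach (T n w) (A n w)) ->
  forall n w, encodes (T n w) (hist A n w).
Proof.
move=> T0 TS; elim=> [|n IH] w; first by rewrite T0; exact: encodes_set0.
by rewrite TS; exact: encodes_attach.
Qed.

(** [is_URRT] states independence from the past trees, whereas the argument conditions on past
    parents. The trees determine the parents, since a newly added vertex has only one neighbour. *)
Lemma hist_eqP (T : forall n : nat, Omega -> graph 'I_n.+1) :
  (forall w, T 0%N w = finset.set0) ->
  (forall n w, T n.+1 w = attach (T n w) (A n w)) ->
  forall n w w0, hist A n w = hist A n w0 <->
    forall k, (k <= n)%N -> T k w = T k w0.
Proof.
move=> T0 TS n w w0; elim: n => [|n IH].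
  by split=> // _ k; rewrite leqn0 => /eqP ->; rewrite !T0.
split=> [/= [/val_inj eA /IH eT] k|eT /=].
  rewrite leq_eqVlt => /orP[/eqP ->|]; last by rewrite ltnS; exact: eT.
  by rewrite !TS eA eT.
have eTn k : (k <= n)%N -> T k w = T k w0 by move=> kn; apply: eT; exact: leqW.
have /IH -> := eTn.
have := eT n.+1 (leqnn _); rewrite !TS eTn // => eE.
have : adj (attach (T n w0) (A n w)) (widen_ord (leqnSn _) (A n w)) ord_max.
  by rewrite adj_attach_new.
by rewrite eE adj_attach_new => /eqP ->.
Qed.

End HistTheory.

Variables (R : realType) (d : measure_display) (Omega : measurableType d).
Variables (P : probability Omega R) (A : forall n : nat, Omega -> 'I_n.+1).
Hypothesis A_meas : forall n (i : 'I_n.+1), measurable [set w | A n w = i].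

Lemma measurable_hist n (Q : set (seq nat)) : measurable [set w | Q (hist A n w)].
Proof.
elim: n Q => [|n IH] Q /=.
  have [q|q] := pselect (Q [::]).
    by rewrite (_ : [set _ | _] = setT) //; apply/seteqP; split.
  by rewrite (_ : [set _ | _] = set0) //; apply/seteqP; split.
rewrite (_ : [set _ | _] =
  \big[setU/set0]_(i : 'I_n.+1) ([set w | A n w = i] `&` [set w | Q (val i :: hist A n w)])).
  apply: bigsetU_measurable => i _; apply: measurableI; first exact: A_meas.
  exact: (IH [set s | Q (val i :: s)]).
apply/seteqP; split=> w /=.
  by move=> q; rewrite -bigcup_seq /=; exists (A n w); rewrite /= ?mem_index_enum.
by rewrite -bigcup_seq /= => -[i _ [/= <-]].
Qed.

Hypothesis P_hist : forall s, valid s ->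
  P [set w | hist A (size s) w = s] = ((size s)`!%:R^-1)%:E.

Variables (f : seq nat -> R) (bad : pred (seq nat)).
Hypothesis f_super : supermartingale f.
Hypothesis f_bad : forall s, valid s -> bad s -> 1 <= f s.

(** A finite horizon [j] and a free initial history [s] permit an induction on [j] in place of
    stopping times. *)
Let B j s := [set w | hist A (size s) w = s /\
  exists2 m, (m <= j)%N & bad (hist A (size s + m) w)].

Let B_meas j s : measurable (B j s).
Proof.
rewrite (_ : B j s = [set w | hist A (size s) w = s] `&`
  \bigcup_(m in [set m | (m <= j)%N]) [set w | bad (hist A (size s + m) w)]).
  apply: measurableI; first exact: (measurable_hist _ [set t | t = s]).
  by apply: bigcup_measurable => m _; exact: (measurable_hist _ [set t | bad t]).
by apply/seteqP; split=> w /= [h [m mj b]]; split=> //; exists m.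
Qed.

(** The bound is [f s] times the probability of the history [s]. *)
Let B_le j s : valid s -> (P (B j s) <= (f s / (size s)`!%:R)%:E)%E.
Proof.
elim: j s => [|j IH] s vs; have [bs|nbs] := boolP (bad s).
- apply: (@le_trans _ _ (P [set w | hist A (size s) w = s])).
    by apply: le_measure; rewrite ?inE //; [exact: (measurable_hist _ [set t | t = s])|move=> w []].
  by rewrite P_hist // lee_fin ler_peMl ?invr_ge0 //; exact: f_bad.
- rewrite (_ : B 0 s = set0) ?measure0 ?lee_fin ?divr_ge0 ?f_super.1 //.
  apply/seteqP; split=> // w [/= h [m]]; rewrite leqn0 => /eqP ->.
  by rewrite addn0 h (negPf nbs).
- apply: (@le_trans _ _ (P [set w | hist A (size s) w = s])).
    by apply: le_measure; rewrite ?inE //; [exact: (measurable_hist _ [set t | t = s])|move=> w []].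
  by rewrite P_hist // lee_fin ler_peMl ?invr_ge0 //; exact: f_bad.
- have vis (i : nat) : (i < (size s).+1)%N -> valid (i :: s).
    by move=> lti; rewrite /= vs andbT -ltnS.
  (* As [s] is not bad, a bad history can only come after the next attachment: split by its parent
     and shorten the horizon by one. *)
  apply: (@le_trans _ _ (P (\big[setU/set0]_(i < (size s).+1) B j (val i :: s)))).
    apply: le_measure; rewrite ?inE //; first exact: bigsetU_measurable.
    move=> w [h [[|m] mj b]]; first by move: b; rewrite addn0 h (negPf nbs).
    rewrite -bigcup_seq; exists (A (size s) w); rewrite /= ?mem_index_enum //.
    by split; rewrite /= ?h //; exists m => //; move: b; rewrite addnS.
  apply: (le_trans (Boole_inequality P (fun i _ => B_meas j (i :: s)))).
  apply: (@le_trans _ _ (\sum_(i < (size s).+1) (f (val i :: s) / (size s).+1`!%:R)%:E)%E).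
    by apply: lee_sum => i _; apply: (IH (val i :: s)); exact: vis (ltn_ord i).
  rewrite sumEFin lee_fin -mulr_suml factS natrM invfM mulrA ler_wpM2r ?invr_ge0 //.
  by rewrite ler_pdivrMr // mulrC; exact: f_super.2.
Qed.

(** Ville's maximal inequality at level one: let the horizon tend to infinity, by continuity of [P]
    from below. *)
Lemma ville : (P [set w | exists n, bad (hist A n w)] <= (f [::])%:E)%E.
Proof.
have -> : [set w | exists n, bad (hist A n w)] = \bigcup_j B j [::].
  apply/seteqP; split=> w /= [n]; first by exists n => //=; split=> //; exists n.
  by move=> _ [_ [m _ b]]; exists m.
have /cvge_to_le : (P \o B^~ [::]) x @[x --> \oo] --> P (\bigcup_j B j [::]).
  apply: nondecreasing_cvg_mu; [by []|by apply: bigcup_measurable|].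
  move=> i j ij; apply/subsetPset => w [h [m mi b]]; split=> //; exists m => //.
  exact: leq_trans ij.
by apply; apply: nearW => j /=; have := B_le j (s := [::]) isT; rewrite /= fact0 divr1.
Qed.

End Probability.

(** * The law of the history and null events *)

Section NullEvents.
Variables (R : realType) (d : measure_display) (Omega : measurableType d).
Variables (P : probability Omega R) (A : forall n : nat, Omega -> 'I_n.+1).
Hypothesis A_meas : forall n (i : 'I_n.+1), measurable [set w | A n w = i].

Lemma P_hist (T : forall n : nat, Omega -> graph 'I_n.+1) :
  (forall w, T 0%N w = finset.set0) ->
  (forall n w, T n.+1 w = attach (T n w) (A n w)) ->
  (forall n (i : 'I_n.+1), P [set w | A n w = i] = (n.+1%:R^-1)%:E) ->
  (forall n (i : 'I_n.+1) (t : forall k : nat, graph 'I_k.+1),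
    let past := [set w | forall k, (k <= n)%N -> T k w = t k] in
    P ([set w | A n w = i] `&` past) = (P [set w | A n w = i] * P past)%E) ->
  forall s, valid s -> P [set w | hist A (size s) w = s] = ((size s)`!%:R^-1)%:E.
Proof.
move=> T0 TS A_unif A_indep; elim=> [|i s IH] /=.
  move=> _; rewrite (_ : [set _ | _] = setT) ?probability_setT ?invr1 //.
  by apply/seteqP; split.
move=> /andP[lei vs]; have {}IH := IH vs.
(* The independence hypothesis needs prescribed trees. A history of positive probability occurs at
   some [w0], whose trees are used. *)
have [w0 /= hw0] : [set w | hist A (size s) w = s] !=set0.
  apply/set0P/eqP => e; move: IH; rewrite e measure0 => /esym /eqP.
  by rewrite eqe invr_eq0 pnatr_eq0 eqn0Ngt fact_gt0.
have pastE : [set w | hist A (size s) w = s] =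
    [set w | forall k, (k <= size s)%N -> T k w = T k w0].
  apply/seteqP; split=> w /= h; first by apply/(hist_eqP T0 TS); rewrite h hw0.
  by rewrite -[RHS]hw0; exact/(hist_eqP T0 TS).
have ltis : (i < (size s).+1)%N by [].
rewrite (_ : [set _ | _] = [set w | A (size s) w = Ordinal ltis] `&`
    [set w | forall k, (k <= size s)%N -> T k w = T k w0]).
  by rewrite A_indep -pastE IH A_unif -EFinM factS natrM invfM.
rewrite -pastE; apply/seteqP; split=> w /=.
  by move=> [Ai e]; split=> //; apply: val_inj.
by move=> [-> ->].
Qed.

Hypothesis P_histE : forall s, valid s ->
  P [set w | hist A (size s) w = s] = ((size s)`!%:R^-1)%:E.

Lemma measurable_exists_hist (bad : pred (seq nat)) :
  measurable [set w | exists n, bad (hist A n w)].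
Proof.
rewrite (_ : [set _ | _] = \bigcup_n [set w | bad (hist A n w)]).
  by apply: bigcupT_measurable => n; exact: (measurable_hist A_meas _ [set t | bad t]).
by apply/seteqP; split=> w [n]; exists n.
Qed.

(** By [ville] the event has probability at most [f k [::]] for every [k]. *)
Lemma supermartingale_negligible (f : nat -> seq nat -> R) (bad : nat -> pred (seq nat)) :
  (forall k, supermartingale (f k)) ->
  (forall k s, valid s -> bad k s -> 1 <= f k s) ->
  (forall e, 0 < e -> exists k, f k [::] <= e) ->
  P.-negligible [set w | forall k, exists n, bad k (hist A n w)].
Proof.
move=> f_super f_bad f0.
pose N := \bigcap_k [set w | exists n, bad k (hist A n w)].
have mN : measurable N by apply: bigcapT_measurable => k; exact: measurable_exists_hist.
exists N; split=> //; last by move=> w h k _; exact: h.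
apply/eqP; rewrite eq_le measure_ge0 andbT; apply/lee_addgt0Pr => e e0.
have [k fk] := f0 e e0; rewrite add0e.
apply: le_trans (_ : (f k [::])%:E <= _)%E; last by rewrite lee_fin.
apply: le_trans (ville A_meas P_histE (f_super k) (f_bad k)).
apply: le_measure; rewrite ?inE //; first exact: measurable_exists_hist.
by move=> w; apply.
Qed.

End NullEvents.

(** * Three supermartingales *)

Section Supermartingales.
Variable R : realType.
Implicit Types (s : seq nat) (v c : nat).

Notation H := (series (@harmonic R)).

Lemma sum_anc s v : \sum_(i < (size s).+1) (anc s v i)%:R = (weight s v)%:R :> R.
Proof. by rewrite /weight natr_sum. Qed.

Lemma harmonicS n : H n.+1 = H n + n.+1%:R^-1.
Proof. by rewrite seriesSr. Qed.

Lemma harmonic_ge0 n : 0 <= H n.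
Proof. by apply: sumr_ge0 => i _ /=; rewrite invr_ge0. Qed.

Lemma harmonic_nd : nondecreasing_seq H.
Proof. by apply/nondecreasing_seqP => n; rewrite harmonicS lerDl invr_ge0. Qed.

Definition tie_potential (x y : R) : R := (x + y) / ((x - y) ^+ 2 + 3 * (x + y)).

(** Among [n] possible parents, [x] make [x] grow, [y] make [y] grow, and the others change nothing;
    adding those and dividing by [n] gives the factor [1 - 1/(8 n)]. *)
Lemma tie_potential_step (x y : R) : 1 <= x -> 1 <= y ->
  x * tie_potential (x + 1) y + y * tie_potential x (y + 1)
    <= (x + y - 8^-1) * tie_potential x y.
Proof.
move=> x1 y1; rewrite /tie_potential.
set a := (x + 1 - y) ^+ 2 + 3 * (x + 1 + y).
set b := (x - (y + 1)) ^+ 2 + 3 * (x + (y + 1)).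
set q := (x - y) ^+ 2 + 3 * (x + y).
have a0 : 0 < a by rewrite /a; have := sqr_ge0 (x + 1 - y); lra.
have b0 : 0 < b by rewrite /b; have := sqr_ge0 (x - (y + 1)); lra.
have q0 : 0 < q by rewrite /q; have := sqr_ge0 (x - y); lra.
rewrite -subr_ge0.
have -> : (x + y - 8^-1) * ((x + y) / q) - (x * ((x + 1 + y) / a) + y * ((x + (y + 1)) / b))
  = ((x + y - 8^-1) * (x + y) * a * b - (x + y + 1) * (x * b + y * a) * q) / (q * a * b).
  by field; rewrite !gt_eqF.
apply: divr_ge0; last by rewrite !mulr_ge0 // ltW.
(* The numerator depends only on the sum [N] and the squared difference [t]. Its quadratic form in
   [t] and [N], shown nonnegative as [h], has negative discriminant. *)
pose N := x + y; pose t := (x - y) ^+ 2.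
have N2 : 2 <= N by rewrite /N; lra.
have t0 : 0 <= t by exact: sqr_ge0.
have -> : (x + y - 8^-1) * (x + y) * a * b - (x + y + 1) * (x * b + y * a) * q
  = N * (7 / 8 * t ^+ 2 - 6 / 8 * t * N + 15 / 8 * N ^+ 2)
    + 2 * t ^+ 2 + 3 / 2 * N * t + N * (N - 2).
  by rewrite /a /b /q /N /t; field.
have h : 0 <= 7 / 8 * t ^+ 2 - 6 / 8 * t * N + 15 / 8 * N ^+ 2 by nra.
have N0 : 0 <= N by lra.
have NN : 0 <= N - 2 by lra.
have := mulr_ge0 N0 h; have := mulr_ge0 N0 NN; have := mulr_ge0 N0 t0; have := sqr_ge0 t; lra.
Qed.

Lemma tie_potential_ge0 (x y : R) : 0 <= x -> 0 <= y -> 0 <= tie_potential x y.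
Proof.
by move=> x0 y0; rewrite divr_ge0 ?addr_ge0 ?sqr_ge0 ?mulr_ge0 ?addr_ge0.
Qed.

Lemma tie_potential_le (x y : R) : 1 <= x -> 1 <= y -> 3 * tie_potential x y <= 1.
Proof.
move=> x1 y1; rewrite /tie_potential mulrA ler_pdivrMr ?mul1r; first by rewrite lerDr sqr_ge0.
by have := sqr_ge0 (x - y); lra.
Qed.

Lemma tie_potential_tie (x : R) : 1 <= x -> 3 * tie_potential x x = 1.
Proof. by move=> x1; rewrite /tie_potential; field; lra. Qed.

(** * Ties between [weight v] and [n - weight c] *)

Section Ties.
Variables (c v : nat).
Hypothesis cv : (0 < c <= v)%N.

(** Only times from [v + k] on count, so ties for every [k] mean infinitely many ties. *)
Definition tie k s : bool :=
  [&& (v + k <= size s)%N, anc s c v & weight s v + weight s c == (size s).+1].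

(** The weight [w], constant from time [v + k] on, absorbs the decay factor
    [1 - 1/(8 n)]; it makes the initial value small for large [k]. *)
Definition tie_mart k s : R :=
  let w n := (8 + H n) / (8 + H (v + k)%N) in
  if (size s < v)%N then w v
  else if anc s c v then
    w (minn (size s) (v + k)%N) *
      (3 * tie_potential (weight s v)%:R ((size s).+1%:R - (weight s c)%:R))
  else 0.

Let w0 n k : 0 <= (8 + H n) / (8 + H (v + k)%N).
Proof. by rewrite divr_ge0 ?addr_ge0 ?harmonic_ge0. Qed.

Let X1 s : (v <= size s)%N -> 1 <= (weight s v)%:R :> R.
Proof. by move=> vs; rewrite ler1n weight_gt0. Qed.

Let Y1 s : valid s -> 1 <= (size s).+1%:R - (weight s c)%:R :> R.
Proof.
move=> vs; rewrite lerBrDr -natr1 addrC lerD2r ler_nat weight_leq //; lia.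
Qed.

Lemma tie_mart_super k : supermartingale (tie_mart k).
Proof.
have aux (g m w w' : R) : 0 <= g -> w * (m - 8^-1) <= m * w' ->
    w * (3 * ((m - 8^-1) * g)) <= m * (w' * (3 * g)).
  by move=> g0 h; have := ler_wpM2r g0 h; lra.
split=> s vs.
  rewrite /tie_mart; case: ltnP => // le; case: ifP => // _.
  rewrite mulr_ge0 ?w0 // mulr_ge0 // tie_potential_ge0 //.
  exact: le_trans ler01 (Y1 vs).
have sz (i : 'I_(size s).+1) : valid (val i :: s) by rewrite /= vs andbT -ltnS.
case: (ltngtP (size s).+1 v) => [lt|gt|e].
- rewrite /tie_mart (ltn_trans _ lt) // (eq_bigr (fun=> (8 + H v) / (8 + H (v + k)%N))).
    by rewrite sumr_const card_ord mulr_natl.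
  by move=> i _; rewrite /= lt.
- have le_v : (v <= size s)%N by [].
  have le_c : (c <= size s)%N by lia.
  have [acv|nacv] := boolP (anc s c v); last first.
    rewrite /tie_mart ltnNge le_v /= (negPf nacv) mulr0 big1 // => i _.
    by rewrite /= !ltn_eqF //= ?ltnNge ?(leqW le_v) ?(negPf nacv) //.
  set X : R := (weight s v)%:R; set Y : R := (size s).+1%:R - (weight s c)%:R.
  set w := (8 + H (minn (size s).+1 (v + k)%N)) / (8 + H (v + k)%N).
  pose al := tie_potential (X + 1) Y; pose be := tie_potential X (Y + 1).
  pose ga := tie_potential X Y.
  (* [X] grows when the parent is below [v], and [Y] when it is not below [c]. As [c] is an ancestor
     of [v], these exclude each other, so the new value is affine in the indicators. *)
  have stepE (i : 'I_(size s).+1) : tie_mart k (val i :: s) =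
      w * (3 * (ga + (anc s v i)%:R * (al - ga) + (1 - (anc s c i)%:R) * (be - ga))).
    have nlt : (size (val i :: s) < v)%N = false by rewrite ltnNge /= leqW.
    rewrite /tie_mart nlt anc_cons // acv !weight_cons ?sz // [size (_ :: _)]/= -/w.
    congr (_ * (3 * _)).
    rewrite -[(size s).+2%:R]natr1 !natrD.
    have := @anc_trans s c v i vs (leq_ord i) acv.
    case: (anc s v i); case: (anc s c i) => //= h; last 2 first.
    + by transitivity ga; [congr tie_potential; rewrite /X /Y; ring|ring].
    + by transitivity be; [congr tie_potential; rewrite /X /Y; ring|ring].
    + by transitivity al; [congr tie_potential; rewrite /X /Y; ring|ring].
    + by have := h isT.
  have gaE : tie_potential X Y = ga by [].
  clearbody ga.
  rewrite (eq_bigr _ (fun i _ => stepE i)) -mulr_sumr -mulr_sumr !big_split /=.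
  rewrite -!mulr_suml sum_anc sumrB sum_anc !sumr_const card_ord -/X -/Y.
  rewrite /tie_mart ltnNge le_v /= acv -/X -/Y gaE.
  have st := tie_potential_step (X1 le_v) (Y1 vs); rewrite -/X -/Y -/al -/be gaE in st.
  have ga0 : 0 <= ga.
    by rewrite -gaE; apply: tie_potential_ge0; rewrite // (le_trans ler01) // Y1.
  pose W := 8 + H (v + k)%N.
  have W0 : 0 < W by rewrite /W; have := harmonic_ge0 (v + k); lra.
  set w' := (8 + H (minn (size s) (v + k)%N)) / _.
  (* Until time [v + k] the harmonic sum gains [1/n], and [(8 + h + 1/n) (n - 1/8) <= n (8 + h)] for
     [h >= 0]; hence the constant [8] in the weight. *)
  have ww : w * ((size s).+1%:R - 8^-1) <= (size s).+1%:R * w'.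
    set n := (size s).+1%:R; have n0 : 0 < n by rewrite ltr0n.
    have h0 := harmonic_ge0 (minn (size s) (v + k)%N).
    have hle : H (minn (size s).+1 (v + k)%N) <= H (minn (size s) (v + k)%N) + n^-1.
      have [lt|ge] := ltnP (size s) (v + k).
        by rewrite (minn_idPl lt) harmonicS.
      by rewrite (minn_idPr (leqW ge)) lerDl invr_ge0 ltW.
    rewrite /w /w' -/W [leLHS]mulrAC [leRHS]mulrA ler_wpM2r ?invr_ge0 ?(ltW W0) //.
    move: hle h0; set h' := H _; set h := H _ => hle h0.
    have n1 : 1 <= n by rewrite ler1n.
    have ni : n * n^-1 = 1 by rewrite divff ?gt_eqF.
    have ni0 : 0 <= n^-1 by rewrite invr_ge0 ltW.
    clearbody h h' n.
    have n8 : 0 <= n - 8^-1 by lra.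
    have hle' : 8 + h' <= 8 + (h + n^-1) by lra.
    have := ler_wpM2r n8 hle'; nra.
  have key : ga *+ (size s).+1 + X * (al - ga) + (1 *+ (size s).+1 - (weight s c)%:R) * (be - ga)
      <= ((size s).+1%:R - 8^-1) * ga.
    rewrite -[ga *+ _]mulr_natl -/Y; lra.
  have wge0 : 0 <= w by exact: w0.
  apply: (@le_trans _ _ (w * (3 * (((size s).+1%:R - 8^-1) * ga)))).
    by rewrite ler_wpM2l // ler_wpM2l.
  exact: aux.
- have nlt : (size s < v)%N by rewrite -e.
  (* At the insertion of [v] the value can only drop, because [3 * tie_potential] is at most [1]. *)
  have tv (i : nat) : valid (i :: s) -> tie_mart k (i :: s) <= (8 + H v) / (8 + H (v + k)%N).
    move=> vi.
    rewrite /tie_mart [size (_ :: _)]/= e ltnn (minn_idPl (leq_addr _ _)).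
    case: ifP => _; last exact: w0.
    rewrite ler_piMr ?w0 // tie_potential_le //.
      by rewrite ler1n -e weight_gt0.
    by have := Y1 vi; rewrite /= e.
  apply: le_trans (ler_sum _ (fun i _ => tv _ (sz i))) _.
  by rewrite sumr_const card_ord /tie_mart nlt mulr_natl.
Qed.

Lemma tie_mart_ge1 k s : valid s -> tie k s -> 1 <= tie_mart k s.
Proof.
move=> vs /and3P[le acv /eqP XY].
have lev : (v <= size s)%N by lia.
rewrite /tie_mart ltnNge lev /= acv (minn_idPr le) divff; last first.
  by rewrite gt_eqF // ltr_pwDl // harmonic_ge0.
rewrite mul1r -XY natrD addrK tie_potential_tie //; exact: X1.
Qed.

(** The initial value [(8 + H v) / (8 + H (v + k))] tends to [0] because the harmonic series
    diverges. *)
Lemma tie_mart_nil_small e : 0 < e -> exists k, tie_mart k [::] <= e.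
Proof.
move=> e0; rewrite /tie_mart /=.
have v0 : (0 < v)%N by lia.
have [n hn] : exists n, (8 + H v) / e <= H n.
  apply: contrapT => /forallNP hn; apply: (@dvg_harmonic R).
  apply: nondecreasing_is_cvgn.
    exact: harmonic_nd.
  exists ((8 + H v) / e) => _ [n _ <-].
  by move: (hn n) => /negP; rewrite -ltNge => /ltW.
exists n; rewrite v0; have hm : H n <= H (v + n)%N.
  exact/harmonic_nd/leq_addl.
rewrite ler_pdivrMr; last by rewrite ltr_pwDl // harmonic_ge0.
rewrite mulrC -ler_pdivrMr // (le_trans hn) // (le_trans hm) // lerDr //.
Qed.

End Ties.
End Supermartingales.

(** * Martingales for subtree sizes *)

Section SizeMartingales.
Variable R : realType.
Implicit Types (s : seq nat) (v c : nat).

Notation H := (series (@harmonic R)).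

Let valid_cons s (i : 'I_(size s).+1) : valid s -> valid (val i :: s).
Proof. by move=> vs; rewrite /= vs andbT -ltnS. Qed.

Section ManyBig.
Variable k : nat.

(** The threshold [eps] is [1/k], and only labels above [M] are considered. *)
Definition big_late M s : bool :=
  has (fun v => (size s).+1 <= k * weight s v)%N (index_iota M.+1 (size s).+1).

(** The last term is the sum of the initial values [2 / ((v + 1) (v + 2))] over
    the vertices [v > M] that have not been inserted yet. *)
Definition big_mart M s : R :=
  let n := (size s).+1 in
  k%:R ^+ 2 * (\sum_(M.+1 <= v < n) ((weight s v)%:R * ((weight s v)%:R + 1) / (n%:R * n.+1%:R))
               + 2 / (maxn n M.+1).+1%:R).

Lemma big_mart_super M : supermartingale (big_mart M).
Proof.
split=> s vs.
  rewrite /big_mart mulr_ge0 ?sqr_ge0 // addr_ge0 ?divr_ge0 //.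
  by apply: sumr_ge0 => v _; rewrite -(natrD _ _ 1) -!natrM divr_ge0.
have [lt|le] := ltnP (size s) M.
  rewrite (eq_bigr (fun=> big_mart M s)); first by rewrite sumr_const card_ord mulr_natl.
  move=> i _; rewrite /big_mart [size (_ :: _)]/=.
  have [l1 l2] : ((size s).+1 <= M.+1)%N /\ ((size s).+2 <= M.+1)%N by split; lia.
  by rewrite !big_geq // (maxn_idPr l1) (maxn_idPr l2).
pose n := (size s).+1.
have stepE (i : 'I_n) : big_mart M (val i :: s) =
  k%:R ^+ 2 * (\sum_(M.+1 <= v < n) (((weight s v)%:R * ((weight s v)%:R + 1) +
     (anc s v i)%:R * (2 * ((weight s v)%:R + 1))) / (n.+1%:R * n.+2%:R)) + 2 / n.+1%:R).
  rewrite /big_mart [size (_ :: _)]/= -/n big_nat_recr //= weight_new ?valid_cons //.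
  rewrite (maxn_idPl _) ?ltnS ?leqW // -addrA; congr (_ * (_ + _)); last first.
    (* The term [2 / ((n + 1) (n + 2))] of the new vertex is what the tail loses from [2 / (n + 1)]
       to [2 / (n + 2)]. *)
    by rewrite -!natr1; field; rewrite !natr1 !pnatr_eq0.
  apply: eq_big_nat => v /andP[Mv vn]; congr (_ / _).
  by rewrite weight_cons ?valid_cons // natrD; case: anc => /=; ring.
rewrite (eq_bigr _ (fun i _ => stepE i)) -mulr_sumr /big_mart -/n mulrCA ler_wpM2l ?sqr_ge0 //.
rewrite big_split /= exchange_big /= sumr_const card_ord [leRHS]mulrDr (maxn_idPl _) ?ltnS //.
apply: lerD; last by rewrite -[leLHS]mulr_natl.
rewrite mulr_sumr; apply: ler_sum => v _.
set x := (weight s v)%:R; rewrite -mulr_suml.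
(* For [x] of the [n] parents, [x (x + 1)] gains [2 (x + 1)]. The total [(n + 2) x (x + 1)] cancels
   the change of denominator exactly. *)
have -> : \sum_(i < n) (x * (x + 1) + (anc s v i)%:R * (2 * (x + 1))) =
    (x * (x + 1)) *+ n + x * (2 * (x + 1)).
  by rewrite big_split /= sumr_const card_ord -mulr_suml sum_anc.
rewrite -[_ *+ n]mulr_natl le_eqVlt; apply/orP; left; apply/eqP.
rewrite -[n.+2%:R]natr1 -[n.+1%:R]natr1; field.
by rewrite !natr1 !pnatr_eq0.
Qed.

(** One large vertex of weight [x] suffices: [k^2 x (x + 1) = k x (k x + k) >= n (n + 1)], as
    [k x >= n] and [k >= 1]. *)
Lemma big_mart_ge1 M s : big_late M s -> 1 <= big_mart M s.
Proof.
move=> /hasP[v]; rewrite mem_index_iota => vM le.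
have n1 := ler1n R (size s).+1; set n := (size s).+1 in le vM n1 *.
have x0 : 0 <= (weight s v)%:R :> R by [].
have nx : n%:R <= k%:R * (weight s v)%:R :> R by rewrite -natrM ler_nat.
have k1 : 1 <= k%:R :> R by rewrite ler1n; lia.
apply: (@le_trans _ _ (k%:R ^+ 2 * ((weight s v)%:R * ((weight s v)%:R + 1) / (n%:R * n.+1%:R)))).
  rewrite mulrA ler_pdivlMr ?mul1r ?mulr_gt0 // -natr1.
  have -> : k%:R ^+ 2 * ((weight s v)%:R * ((weight s v)%:R + 1)) =
    (k%:R * (weight s v)%:R) * (k%:R * (weight s v)%:R + k%:R) :> R by ring.
  by rewrite ler_pM ?lerD ?addr_ge0.
rewrite /big_mart ler_wpM2l ?sqr_ge0 // -/n (big_rem v) ?mem_index_iota //= -addrA lerDl.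
by rewrite addr_ge0 ?divr_ge0 // sumr_ge0 // => u _; rewrite -(natrD _ _ 1) -!natrM divr_ge0.
Qed.

Lemma inv_small (x e : R) : 0 < e -> exists n, x / n.+1%:R <= e.
Proof.
move=> e0; exists (Num.trunc `|x / e|).
rewrite ler_pdivrMr // mulrC -ler_pdivrMr //.
by apply: le_trans (ler_norm _) (ltW _); rewrite truncnS_gt.
Qed.

Lemma big_mart_nil_small e : 0 < e -> exists M, big_mart M [::] <= e.
Proof.
move=> e0; have [M hM] := inv_small (k%:R ^+ 2 * 2) e0; exists M.
rewrite /big_mart /= big_geq // add0r (maxn_idPr _) // mulrA (le_trans _ hM) //.
by rewrite ler_wpM2l ?mulr_ge0 ?sqr_ge0 // lef_pV2 ?posrE // ler_nat.
Qed.

End ManyBig.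

(** * Size of the complement of a subtree *)

Section Complement.
Variable c : nat.
Hypothesis c0 : (0 < c)%N.

(** With [n = size s + 1] and [y = n - weight s c], the difference is [1/y + ... + 1/(n - 1)]. *)
Definition dominant k s : bool :=
  (c <= size s)%N && (k.+1%:R <= H (size s) - H (size s - weight s c)%N).

(** Until [c] is inserted, the value is the one that it takes at insertion. *)
Definition dominant_mart k s : R :=
  (if (size s < c)%N then c%:R^-1 else H (size s) - H (size s - weight s c)%N) / k.+1%:R.

Lemma dominant_mart_super k : supermartingale (dominant_mart k).
Proof.
split=> s vs.
  rewrite /dominant_mart divr_ge0 //; case: ifP => // _.
  by rewrite subr_ge0 harmonic_nd ?leq_subr.
rewrite /dominant_mart -mulr_suml mulrA ler_wpM2r ?invr_ge0 //=.
have [lt|gt|e] := ltngtP (size s).+1 c.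
- by rewrite sumr_const card_ord mulr_natl.
- have lec : (c <= size s)%N by [].
  set m := (size s - weight s c)%N; set n := (size s).+1.
  have Sle := weight_leq vs c0.
  (* Each parent adds [1/n], and each of the [y = m + 1] parents not below [c] also removes [1/y];
     summed over all parents the two effects cancel. *)
  have stepE (i : 'I_n) : H n - H (n - weight (val i :: s) c)%N =
      H n - H m - m.+1%:R^-1 + (anc s c i)%:R * m.+1%:R^-1.
    rewrite weight_cons ?valid_cons //; case: anc => /=.
      by rewrite mul1r subrK addn1 subSS.
    by rewrite mul0r addr0 addn0 subSn // harmonicS; ring.
  rewrite (eq_bigr _ (fun i _ => stepE i)) big_split /= -mulr_suml sum_anc sumr_const card_ord.
  rewrite -[_ *+ n]mulr_natl -/n harmonicS.
  have -> : (weight s c)%:R = n%:R - m.+1%:R :> R by rewrite -natrB ?subSS ?subKn // ltnS leq_subr.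
  have n0 : n%:R != 0 :> R by rewrite pnatr_eq0.
  have m0 : m.+1%:R != 0 :> R by rewrite pnatr_eq0.
  rewrite le_eqVlt; apply/orP; left; apply/eqP.
  by move: (H _) (H _) n%:R m.+1%:R n0 m0 => a b x y x0 y0; field; rewrite x0 y0.
- rewrite -[X in _ <= _ / X%:R]e (eq_bigr (fun=> (size s).+1%:R^-1)).
    by rewrite sumr_const card_ord mulr_natl.
  move=> i _; rewrite -[X in weight _ X]e weight_new ?valid_cons //.
  by rewrite subn1 harmonicS addrC addKr.
Qed.

Lemma dominant_mart_ge1 k s : dominant k s -> 1 <= dominant_mart k s.
Proof.
move=> /andP[le h]; rewrite /dominant_mart ltnNge le /= ler_pdivlMr ?mul1r //.
Qed.

Lemma dominant_mart_nil_small e : 0 < e -> exists k, dominant_mart k [::] <= e.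
Proof.
move=> e0; rewrite /dominant_mart /= c0; exact: inv_small.
Qed.

End Complement.

(** Each of the [m + 1] additional terms is at least [1/(2 m + 1)]. *)
Lemma harmonic_half m : H m + 2^-1 <= H m.*2.+1.
Proof.
have h j : H m + j%:R / (m + j)%:R <= H (m + j)%N.
  elim: j => [|j IH]; first by rewrite mul0r addr0 addn0.
  rewrite addnS harmonicS -[j.+1%:R]natr1 mulrDl mul1r addrA lerD2r (le_trans _ IH) // lerD2l.
  case: (posnP (m + j)) => [e|mj0]; first by rewrite (_ : j = 0)%N ?mul0r //; lia.
  by rewrite ler_wpM2l // lef_pV2 ?posrE ?ltr0n // ler_nat.
rewrite -addnn -addnS; apply: le_trans (h m.+1); rewrite lerD2l.
rewrite addnS ler_pdivlMr // mulrC ler_pdivrMr // -natrM ler_nat; lia.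
Qed.

Lemma harmonic_gap j m n : (2 ^ j * m.+1 <= n.+1)%N -> H m + j%:R / 2 <= H n.
Proof.
elim: j n => [|j IH] n le; first by rewrite mul0r addr0 harmonic_nd //; lia.
have [p hp] : exists p, p.+1 = (2 ^ j * m.+1)%N.
  by exists (2 ^ j * m.+1).-1; rewrite prednK // muln_gt0 expn_gt0.
have le1 : (p.*2.+1 <= n)%N by move: le; rewrite expnS -mulnA -hp; lia.
apply: le_trans (_ : H p.*2.+1 <= _); last exact: harmonic_nd.
apply: le_trans (harmonic_half p).
by rewrite -natr1 mulrDl mul1r addrA lerD2r IH // hp.
Qed.

(** Let [y = n - weight s c]. If [n] exceeded [2^(2 (k + 1)) y], then [2 (k + 1)] doublings, each
    adding at least [1/2], would bring [1/y + ... + 1/(n - 1)] up to [k + 1]. *)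
Lemma dominant_bound c k : exists K, forall s, valid s -> (0 < c <= size s)%N ->
  ~~ dominant c k s -> ((size s).+1 <= K * ((size s).+1 - weight s c))%N.
Proof.
exists (2 ^ (k.+1.*2))%N => s vs /andP[c0 le]; rewrite /dominant le /= -ltNge.
have Sle := weight_leq vs c0.
move=> h; rewrite leqNgt subSn //; apply: contraTN h => lt.
rewrite -leNgt lerBrDl; apply: le_trans (harmonic_gap (ltnW lt)).
by rewrite lerD2l -muln2 natrM mulfK.
Qed.

End SizeMartingales.

(** * Eventual constancy *)

Section Stabilization.

Definition stabilizes (T : Type) (b : nat -> T) : Prop :=
  exists N x, forall n, (N <= n)%N -> b n = x.

Lemma stabilizes2 (T1 T2 T3 : Type) (op : T1 -> T2 -> T3) b1 b2 :
  stabilizes b1 -> stabilizes b2 -> stabilizes (fun n => op (b1 n) (b2 n)).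
Proof.
move=> [N1 [x1 h1]] [N2 [x2 h2]]; exists (maxn N1 N2), (op x1 x2) => n.
by rewrite geq_max => /andP[/h1 -> /h2 ->].
Qed.

Lemma stabilizes_foldr (I : eqType) (T1 T2 : Type) (op : T1 -> T2 -> T2) (x : T2)
    (b : nat -> I -> T1) (l : seq I) :
  (forall i, i \in l -> stabilizes (b^~ i)) ->
  stabilizes (fun n => foldr op x (map (b n) l)).
Proof.
elim: l => [|i l IH] h; first by exists 0%N, x.
apply: (stabilizes2 op); first by apply: h; rewrite mem_head.
by apply: IH => j jl; apply: h; rewrite inE jl orbT.
Qed.

Lemma stabilizes_has (I : eqType) (b : nat -> pred I) (l : seq I) :
  (forall i, i \in l -> stabilizes (b^~ i)) -> stabilizes (fun n => has (b n) l).
Proof.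
move=> /(stabilizes_foldr orb false) [N [x h]]; exists N, x => n /h <-.
by elim: l {h} => //= i l ->.
Qed.

Lemma stabilizes_count (I : eqType) (b : nat -> pred I) (l : seq I) :
  (forall i, i \in l -> stabilizes (b^~ i)) -> stabilizes (fun n => count (b n) l).
Proof.
move=> /(stabilizes_foldr (fun (a : bool) m => a + m)%N 0%N) [N [x h]]; exists N, x => n /h <-.
by elim: l {h} => //= i l ->.
Qed.

Variables (R : realType) (Omega : Type) (A : forall n : nat, Omega -> 'I_n.+1) (w : Omega).
Let h n := hist A n w.
Let h_valid n : valid (h n). Proof. exact: valid_hist. Qed.
Let h_size n : size (h n) = n. Proof. exact: size_hist. Qed.

Let anc_h c v n : (v <= n)%N -> anc (h n) c v = anc (h v) c v.
Proof.
elim: n => [|n IH]; first by rewrite leqn0 => /eqP ->.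
rewrite leq_eqVlt => /orP[/eqP -> //|]; rewrite ltnS => vn.
by rewrite -IH //; apply: anc_cons; rewrite h_size.
Qed.

Let weight_h n u : (u <= n)%N -> weight (h n.+1) u = (weight (h n) u + anc (h n) u (A n w))%N.
Proof. by move=> un; apply: weight_cons; rewrite ?h_size //; exact: (h_valid n.+1). Qed.

(** The difference between [weight v + weight c] and the number of vertices moves by at most one per
    step, so it cannot change sign without a tie. *)
Lemma stabilizes_pair c v : (0 < c <= v)%N ->
  (exists k, forall n, ~~ tie c v k (h n)) ->
  stabilizes (fun n => anc (h n) c v && (n < weight (h n) v + weight (h n) c)%N).
Proof.
move=> /andP[c0 cv] [k no_tie]; have [acv|nacv] := boolP (anc (h v) c v); last first.
  by exists v, false => n vn; rewrite anc_h // (negPf nacv).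
exists (v + k)%N, ((v + k)%N < weight (h (v + k)%N) v + weight (h (v + k)%N) c)%N => n /subnKC <-.
elim: (n - (v + k))%N => [|j IH]; first by rewrite addn0 anc_h ?acv ?leq_addr.
rewrite -{}IH addnS; set m := (v + k + j)%N.
have vm : (v <= m)%N by rewrite /m -addnA leq_addr.
have no m' : (v + k <= m')%N -> (weight (h m') v + weight (h m') c)%N != m'.+1.
  move=> le; have := no_tie m'; rewrite /tie h_size le anc_h ?acv //.
  exact: leq_trans (leq_addr _ _) le.
have /eqP n1 := no m (leq_addr _ _).
have /eqP := no m.+1 (leqW (leq_addr _ _)).
rewrite !anc_h ?leqW // acv /= !weight_h ?(leq_trans cv) //.
have := @anc_trans (h m) c v (A m w) (h_valid m).
rewrite h_size anc_h // => /(_ (leq_ord _) acv).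
case: (anc _ v _); case: (anc _ c _) => //= H; move: n1; last 2 first.
- lia.
- lia.
- lia.
- by have := H isT.
Qed.

Hypothesis no_ties : forall c v, (0 < c <= v)%N -> exists k, forall n, ~~ tie c v k (h n).
Hypothesis no_big : forall k, exists M, forall n, ~~ big_late k M (h n).
Hypothesis no_dominant : forall c, (0 < c)%N -> exists k, forall n, ~~ dominant R c k (h n).

Let big_bound k : exists M, forall n v, (M < v <= n)%N -> (k * weight (h n) v <= n)%N.
Proof.
have [M hM] := no_big k; exists M => n v vn.
have /hasPn/(_ v) := hM n; rewrite mem_index_iota h_size ltnS => /(_ vn).
by rewrite -ltnNge ltnS.
Qed.

Let complement_bound M : exists K, forall c n, (0 < c <= M)%N -> (c <= n)%N ->
  (n.+1 <= K * (n.+1 - weight (h n) c))%N.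
Proof.
elim: M => [|M [K hK]]; first by exists 0%N => c n; lia.
have [k hk] := no_dominant (ltn0Sn M).
have [K' hK'] := dominant_bound R M.+1 k.
exists (K + K')%N => c n /andP[c0]; rewrite leq_eqVlt => /orP[/eqP ->|cM] cn; rewrite mulnDl.
  by have := hK' (h n) (h_valid n); rewrite h_size => /(_ cn (hk n)); lia.
by have := hK c n; rewrite c0 => /(_ cM cn); lia.
Qed.

(** If [c > M], then [weight v <= weight c <= n / 2], too small to beat the root. So [c <= M], and
    [weight v] must reach the complement of [c], a fraction at least [1/K] of the tree, which no
    late [v] does. *)
Lemma beats_root_bounded : exists K, forall n v, (K < v <= n)%N -> ~~ beats_root (h n) v.
Proof.
have [M hM] := big_bound 2.
have [K hK] := complement_bound M.
have [K' hK'] := big_bound K.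
exists K' => n v vn; apply/negP => /beats_rootP[c [c0 cv acv]]; rewrite h_size => lt.
have Sle := weight_anc (h_valid n) acv.
have cM : (c <= M)%N.
  by rewrite leqNgt; apply/negP => Mc; have := hM n c; lia.
have := hK c n; rewrite c0 cM => /(_ isT).
have := hK' n v vn.
have le : (n.+1 - weight (h n) c <= weight (h n) v)%N by lia.
have := leq_mul (leqnn K) le; lia.
Qed.

Lemma stabilizes_rank : stabilizes (fun n => (count (beats_root (h n)) (iota 1 n)).+1).
Proof.
have [K hK] := beats_root_bounded.
have [N [x hx]] : stabilizes (fun n => count (beats_root (h n)) (iota 1 K)).
  apply: (stabilizes_count (b := fun n => beats_root (h n))) => v _.
  have [N [x hx]] : stabilizes (fun n =>
      has (fun c => anc (h n) c v && (n < weight (h n) v + weight (h n) c)%N) (iota 1 v)).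
    apply: (stabilizes_has (b := fun n c =>
      anc (h n) c v && (n < weight (h n) v + weight (h n) c)%N)) => c.
    by rewrite mem_iota add1n ltnS => cv; apply: stabilizes_pair => //; exact: no_ties.
  by exists N, x => n /hx; rewrite /beats_root h_size.
exists (maxn N K), x.+1 => n; rewrite geq_max => /andP[Nn Kn]; congr _.+1.
rewrite -(subnKC Kn) iotaD count_cat (subnKC Kn) hx // (_ : count _ _ = 0%N) ?addn0 //.
apply/eqP; rewrite -leqn0 leqNgt -has_count; apply/hasPn => v.
by rewrite mem_iota => vK; apply: hK; lia.
Qed.

End Stabilization.

(** * A measurable limit *)

Section EventualValue.
Variables (R : realType) (d : measure_display) (Omega : measurableType d).
Variables (P : probability Omega R) (r : nat -> Omega -> nat).
Hypothesis r_meas : forall n k, measurable [set w | r n w = k].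

Let eventual k := [set w | exists N, forall n, (N <= n)%N -> r n w = k].

Let eventual_meas k : measurable (eventual k).
Proof.
rewrite (_ : eventual k = \bigcup_N \bigcap_(n in [set n | (N <= n)%N]) [set w | r n w = k]).
  by apply: bigcupT_measurable => N; apply: bigcap_measurableType.
by apply/seteqP; split=> w [N]; [exists N | move=> _ h; exists N].
Qed.

(** Where [r] does not settle, [xget] returns the default [0], so the value is an integer
    everywhere. *)
Let value w := xget 0%N [set k | eventual k w].

Let valueE w k : eventual k w -> value w = k.
Proof.
move=> ek; apply: xget_subset1 => // i j [N hN] [M hM].
by rewrite -(hN (maxn N M)) ?leq_maxl // (hM (maxn N M)) ?leq_maxr.
Qed.

Let value_meas k : measurable [set w | value w = k].
Proof.
rewrite (_ : [set w | _] = eventual k `|` (~` (\bigcup_j eventual j) `&` [set _ | k = 0%N])).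
  apply: measurableU => //; apply: measurableI; first exact/measurableC/bigcupT_measurable.
  have [->|k0] := eqVneq k 0%N.
    by rewrite (_ : [set _ | _] = setT) //; apply/seteqP; split.
  by rewrite (_ : [set _ | _] = set0) //; apply/seteqP; split=> // w /= /eqP; rewrite (negPf k0).
apply/seteqP; split=> w /=.
  move=> <-; have [[j ej]|ne] := pselect (exists j, eventual j w).
    by left; rewrite (valueE ej).
  right; split; first by move=> [j _ ej]; apply: ne; exists j.
  by apply: xgetPN => j ej; apply: ne; exists j.
case=> [/valueE //|[ne ->]]; apply: xgetPN => j ej; apply: ne; exact: (ex_intro2 _ _ j).
Qed.

Lemma eventual_value : exists X : {RV P >-> R}, (forall w, X w \is a Num.int) /\
  forall w, stabilizes (r^~ w) -> (r n w)%:R @[n --> \oo] --> X w.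
Proof.
have mX : measurable_fun setT (fun w => (value w)%:R : R).
  move=> _ Y mY; rewrite setTI.
  rewrite (_ : _ @^-1` _ = \bigcup_(k in [set k : nat | Y k%:R]) [set w | value w = k]).
    exact: bigcup_measurable.
  by apply/seteqP; split=> w /= => [h|[k yk ->]] //; exists (value w).
exists (mfun_Sub (mem_set mX)); split=> w; first exact: natr_int.
move=> [N [x h]]; apply: cvg_near_cst; exists N => // n /= Nn.
by rewrite h //=; congr (_%:R); apply/esym/valueE; exists N.
Qed.

End EventualValue.

(** * Almost sure convergence of the rank *)

Theorem theorem17 (R : realType) (d : measure_display)
    (Omega : measurableType d) (P : probability Omega R)
    (T : forall n : nat, Omega -> graph 'I_n.+1) (hT : is_URRT P T) :
  exists X : {RV P >-> R},
    (forall w, X w \is a Num.int) /\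
    {ae P, forall w, (jordan_rank (T n w) ord0)%:R @[n --> \oo] --> X w}.
Proof.
have [A [A_meas T0 TS A_unif A_indep]] := hT.
have P_histE := P_hist T0 TS A_unif A_indep.
have rankE n w := rank_root (encodes_hist T0 TS n w).
have [X [X_int X_lim]] := eventual_value P
  (r := fun n w => (count (beats_root (hist A n w)) (iota 1 n)).+1)
  (fun n k => measurable_hist A_meas n [set s | (count (beats_root s) (iota 1 n)).+1 = k]).
exists X; split=> //.
have null := supermartingale_negligible A_meas P_histE.
pose always (bad : nat -> pred (seq nat)) := [set w | forall k, exists n, bad k (hist A n w)].
(* The unions run over all labels; inadmissible ones contribute the empty set. *)
have ties : P.-negligible (\bigcup_c \bigcup_v
    (if (0 < c <= v)%N then always (tie c v) else set0)).
  apply: negligible_bigcup => c; apply: negligible_bigcup => v.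
  case: ifP => cv; last exact: negligible_set0.
  apply: null (tie_mart_super R cv) _ _; first exact: tie_mart_ge1.
  exact: tie_mart_nil_small.
have bigs : P.-negligible (\bigcup_k always (big_late k)).
  apply: negligible_bigcup => k; apply: null (@big_mart_super R k) _ _.
    by move=> M s _; exact: big_mart_ge1.
  exact: big_mart_nil_small.
have dominants : P.-negligible (\bigcup_c
    (if (0 < c)%N then always (dominant R c) else set0)).
  apply: negligible_bigcup => c; case: ifP => c0; last exact: negligible_set0.
  apply: null (@dominant_mart_super R c c0) _ _; last exact: dominant_mart_nil_small.
  by move=> k s _; exact: dominant_mart_ge1.
(* By contraposition, an outcome without the limit lies in one of the three null sets. *)
apply: negligibleS (negligibleU ties (negligibleU bigs dominants)) => w /=.
apply: contra_notP => /not_orP[no_tie /not_orP[no_big no_dominant]].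
have nalways bad : ~ always bad w -> exists k, forall n, ~~ bad k (hist A n w).
  move=> /existsNP[k /forallNP h]; exists k => n; exact/negP.
under eq_fun => n do rewrite rankE.
apply: X_lim; apply: (@stabilizes_rank R).
- move=> c v cv; apply: nalways => h; apply: no_tie.
  by exists c => //; exists v; rewrite ?cv.
- by move=> k; apply: nalways => h; apply: no_big; exists k.
- move=> c c0; apply: nalways => h; apply: no_dominant.
  by exists c; rewrite ?c0.
Qed.
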